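(* Let $m$ be a positive integer and let $\alpha_1,\beta_1,\alpha_2,\beta_2$ be real numbers with $\alpha_1,\alpha_2$ positive, irrational and satisfying $\frac{1}{\alpha_1}+\frac{1}{\alpha_2} = m$. Then $\{S(\alpha_1,\beta_1), S(\alpha_2,\beta_2)\}$ is an $m$-EEC if and only if $$\frac{\beta_1}{\alpha_1} + \frac{\beta_2}{\alpha_2} \in \mathbb{Z}.$$
   Context: $\mathbb{N}$ denotes the set of positive integers. For real $\alpha>0$ and real $\beta$, the Beatty sequence $S(\alpha,\beta)$ is the multiset $\{\lfloor n\alpha+\beta\rfloor : n\in\mathbb{N}\}$ (an integer is counted as many times as it occurs). A finite family of multisets of integers is an $m$-EEC (eventual exact $m$-cover) if every sufficiently large positive integer occurs exactly $m$ times in the multiset union of the family, counting multiplicities. *)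

(* Defs.v *)
From mathcomp Require Import all_boot all_order all_algebra archimedean.
From mathcomp Require Import all_classical all_reals all_analysis.

Set Implicit Arguments.
Unset Strict Implicit.
Unset Printing Implicit Defensive.

Import Order.TTheory GRing.Theory Num.Theory.

Local Open Scope classical_set_scope.
Local Open Scope ring_scope.

(* A multiset of integers is given by its multiplicity function; the values
   are extended reals so that [counting] applies directly, with +oo standing
   for an element that occurs infinitely often. *)
Definition zmultiset (R : realType) : Type := int -> \bar R.

Definition beatty (R : realType) (alpha beta : R) : zmultiset R :=
  fun k => counting [set n : nat | (0 < n)%N /\ Num.floor (n%:R * alpha + beta) = k].

(* Families are sequences, so a multiset listed twice is counted twice. *)
Definition is_EEC (R : realType) (m : nat) (F : seq (zmultiset R)) : Prop :=
  \forall k \near \oo, (\sum_(S <- F) S k%:Z)%E = m%:R%:E.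

(* Main.v *)
Require Import Defs.
From mathcomp Require Import all_boot all_order all_algebra archimedean finmap.
From mathcomp Require Import all_classical all_reals all_analysis.
From mathcomp Require Import zify ring lra.

Import Order.TTheory GRing.Theory Num.Theory.

Local Open Scope classical_set_scope.
Local Open Scope ring_scope.

(* For large k the number of n >= 1 with floor (n * alpha + beta) = k is
   ceil ((k + 1 - beta) / alpha) - ceil ((k - beta) / alpha). Put
   x_k = (k - beta1) / alpha1 and s = beta1 / alpha1 + beta2 / alpha2. Since
   1 / alpha1 + 1 / alpha2 = m, we have (k - beta2) / alpha2 = k * m - x_k - s, so
   the cover is exact from some point on iff ceil x_k + ceil (- x_k - s) is
   eventually constant. If s is an integer the sum is 1 - s unless x_k is an
   integer, which happens for at most one k. Otherwise the sum takes two
   distinct values according to the position of x_k modulo 1, and both occur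
   for arbitrarily large k by Kronecker's density theorem. *)

Lemma counting_nat_itv (R : realType) (a b : nat) :
  counting [set n : nat | (a <= n < b)%N] = (b - a)%:R%:E :> \bar R.
Proof.
have -> : [set n : nat | (a <= n < b)%N]
    = [set` seq_fset tt (iota a (b - a))].
  by apply/seteqP; split => n; rewrite /mkset seq_fsetE mem_iota; lia.
rewrite /counting asboolT; last exact: finite_fset.
by rewrite set_fsetK size_seq_fset undup_id ?iota_uniq// size_iota.
Qed.

(** The floor equals [k] iff [n] lies in the half-open interval from [(k - beta) / alpha] to
    [(k + 1 - beta) / alpha]. Since [beta < k], its lower end is positive, so [0 < n] is
    automatic. *)
Lemma beatty_ceil (R : realType) (alpha beta : R) (k : int) :
  0 < alpha -> beta < k%:~R ->
  beatty alpha beta k =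
  (Num.ceil ((k + 1)%:~R / alpha - beta / alpha)
   - Num.ceil (k%:~R / alpha - beta / alpha))%:~R%:E.
Proof.
move=> a0 bk.
set b := Num.ceil _; set a := Num.ceil _.
have a_gt0 : 0 < a by rewrite ceil_gt0 -mulrBl divr_gt0// subr_gt0.
have ab : a <= b.
  by apply: le_ceil; rewrite lerD2r ler_pM2r ?invr_gt0// ler_int lerDl.
rewrite /beatty.
have -> : [set n : nat | (0 < n)%N /\ Num.floor (n%:R * alpha + beta) = k]
   = [set n : nat | (`|a| <= n < `|b|)%N].
  apply/seteqP; split => n /=.
    move=> [_ /eqP]; rewrite floor_eq => /andP[kn nk].
    have an : a <= n%:Z.
      by rewrite ceil_le_int -mulrBl ler_pdivrMr// lerBlDr.
    have nb : n%:Z < b.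
      by rewrite ceil_gt_int -mulrBl ltr_pdivlMr// ltrBrDr.
    by lia.
  move=> nab; split; first by lia.
  have : a <= n%:Z by lia.
  rewrite ceil_le_int -mulrBl ler_pdivrMr// lerBlDr => kn.
  have : n%:Z < b by lia.
  rewrite ceil_gt_int -mulrBl ltr_pdivlMr// ltrBrDr => nk.
  by apply/eqP; rewrite floor_eq kn nk.
rewrite counting_nat_itv; congr (_%:E).
by rewrite -[LHS]/((`|b| - `|a|)%N%:~R); congr (_%:~R); lia.
Qed.

(** Pigeonhole: with [1 / N < d], two of the [N + 1] fractional parts [fr 0, ..., fr N] share one of
    the [N] boxes of width [1 / N], and the difference of their indices is [q]. *)
Lemma dirichlet_approx (R : realType) (gamma d : R) : 0 < d ->
  exists q : nat, exists p : int,
    (0 < q)%N /\ `|q%:R * gamma - p%:~R| < d.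
Proof.
move=> d0.
pose N := (Num.trunc d^-1).+1.
have N0 : 0 < N%:R :> R by rewrite ltr0n.
have Nd : 1 < N%:R * d.
  have /truncn_itv/andP[_] : 0 <= d^-1 by rewrite invr_ge0 ltW.
  by rewrite -ltr_pdivrMr// mul1r.
pose fr (i : nat) : R := i%:R * gamma - (Num.floor (i%:R * gamma))%:~R.
have fr_itv i : 0 <= fr i < 1.
  by rewrite /fr; have := floor_itv (i%:R * gamma); rewrite intrD; lra.
pose f (i : 'I_N.+1) : 'I_N := inord (Num.trunc (N%:R * fr i)).
have Nfr_ge0 i : 0 <= N%:R * fr i.
  by have /andP[? _] := fr_itv i; rewrite mulr_ge0// ltW.
have fE (i : 'I_N.+1) : (f i : nat) = Num.trunc (N%:R * fr i).
  rewrite inordK// -(ltr_nat R).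
  have /andP[h _] := truncn_itv (Nfr_ge0 i); apply: le_lt_trans h _.
  by have /andP[_ h] := fr_itv i; rewrite -[ltRHS]mulr1 ltr_pM2l.
have /injectivePn[i [j ij fij]] : ~~ injectiveb f.
  by apply/negP => /injectiveP /leq_card; rewrite !card_ord ltnn.
wlog ltij : i j ij fij / (i < j)%N.
  move=> wl; have [ltij|ltji|/ord_inj eij] := ltngtP i j.
  - exact: wl ltij.
  - by apply: (wl j i); rewrite // eq_sym.
  - by rewrite eij eqxx in ij.
exists (j - i)%N, (Num.floor (j%:R * gamma) - Num.floor (i%:R * gamma)).
split; first by rewrite subn_gt0.
have -> : (j - i)%N%:R * gamma
    - (Num.floor (j%:R * gamma) - Num.floor (i%:R * gamma))%:~R
    = fr j - fr i.
  by rewrite natrB 1?ltnW// intrB /fr; ring.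
rewrite -(ltr_pM2l N0); apply: lt_trans Nd.
rewrite -[X in X * _]gtr0_norm// -normrM mulrBr.
have := truncn_itv (Nfr_ge0 i); have := truncn_itv (Nfr_ge0 j).
rewrite -!fE fij -natr1 ltr_norml; lra.
Qed.

Lemma natmul_irrational_neq (R : realType) (gamma : R) (q : nat) (p : int) :
  gamma \in @irrational R -> (0 < q)%N -> q%:R * gamma != p%:~R.
Proof.
move=> /set_mem girr q0; apply/eqP => e; apply: girr.
exists (p%:~R / q%:R) => //.
rewrite fmorph_div/= ratr_int ratr_nat -e mulrAC divff ?mul1r//.
by rewrite pnatr_eq0 -lt0n.
Qed.

Lemma irrationalV (R : realType) (x : R) :
  x \in @irrational R -> x^-1 \in @irrational R.
Proof.
move=> /set_mem xirr; apply/mem_set => -[q _ qx]; apply: xirr.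
by exists q^-1 => //; rewrite fmorphV/= qx invrK.
Qed.

Lemma irrationalN (R : realType) (x : R) :
  x \in @irrational R -> - x \in @irrational R.
Proof.
move=> /set_mem xirr; apply/mem_set => -[q _ qx]; apply: xirr.
by exists (- q) => //; rewrite rmorphN/= qx opprK.
Qed.

(* Kronecker's theorem, with hits beyond any prescribed rank: the progression
   of step [q], where [q * gamma] is within [b - a] of an integer, moves modulo 1
   in steps too short to jump over [(a, b)]. *)
Lemma kronecker (R : realType) (gamma c a b : R) (K : nat) :
  gamma \in @irrational R -> a < b ->
  exists k : nat, exists p : int,
    (K <= k)%N /\ a < k%:R * gamma + c - p%:~R < b.
Proof.
move=> girr ab.
have [q [p [q0 qp]]] := @dirichlet_approx R gamma (b - a) ltac:(lra).
have : q%:R * gamma - p%:~R != 0.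
  by rewrite subr_eq0 natmul_irrational_neq.
(* Negating [gamma], [c], [p] and the target interval reverses the sign of the step. *)
wlog thgt0 : gamma c a b p girr ab qp / 0 < q%:R * gamma - p%:~R.
  move=> wl th0.
  have [thgt0|] := ltP 0 (q%:R * gamma - p%:~R); first exact: wl qp thgt0 th0.
  rewrite le_eqVlt (negbTE th0)/= => thlt0.
  have e : q%:R * - gamma - (- p)%:~R = - (q%:R * gamma - p%:~R).
    by rewrite intrN; ring.
  have [||||k [p' [Kk /andP[h1 h2]]]] :=
    wl (- gamma) (- c) (- b) (- a) (- p) (irrationalN _ _ girr).
  - by lra.
  - by rewrite e normrN; lra.
  - by rewrite e; lra.
  - by rewrite e oppr_eq0.
  exists k, (- p'); split=> //; rewrite intrN; lra.
set th := q%:R * gamma - p%:~R in qp thgt0 * => _.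
have {}qp : th < b - a by rewrite gtr0_norm in qp.
pose z := K%:R * gamma + c.
(* Shifting by [p0] puts the start at or below [a]. If [j] is the largest number of steps [th] that
   stay at or below [a], one more step lands above [a] and at most at [a + th < b]. *)
pose p0 := Num.ceil (z - a).
have zp0 : z - p0%:~R <= a by have := ceil_itv (z - a); rewrite -/p0; lra.
have w0 : 0 <= (a - (z - p0%:~R)) / th by rewrite divr_ge0; lra.
have := truncn_itv w0.
set j := Num.trunc _ => /andP[].
rewrite ler_pdivlMr// ltr_pdivrMr// => h1 h2.
exists (K + j.+1 * q)%N, (p0 + j.+1%:Z * p); split; first exact: leq_addr.
have -> : (K + j.+1 * q)%N%:R * gamma + c - (p0 + j.+1%:Z * p)%:~R
    = z - p0%:~R + j.+1%:R * th.
  by rewrite natrD natrM intrD intrM /z /th; ring.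
by move: h1 h2; rewrite -natr1 mulrDl mul1r; lra.
Qed.

(** For large [k] the total multiplicity of [k] is the first difference of [F], and
    [F k = G k + k * m]; so it equals [m] exactly when [G] does not change from [k] to [k + 1]. *)
Lemma is_EEC_beatty_pair (R : realType) (m : nat)
    (alpha1 beta1 alpha2 beta2 : R) :
  0 < alpha1 -> 0 < alpha2 -> 1 / alpha1 + 1 / alpha2 = m%:R ->
  let G (k : nat) :=
    Num.ceil (k%:R / alpha1 - beta1 / alpha1) +
    Num.ceil (- (k%:R / alpha1 - beta1 / alpha1)
              - (beta1 / alpha1 + beta2 / alpha2)) in
  is_EEC m [:: beatty alpha1 beta1; beatty alpha2 beta2] <->
  \forall k \near \oo, G k.+1 = G k.
Proof.
move=> a10 a20 sum_inv G.
pose F (k : nat) := Num.ceil (k%:R / alpha1 - beta1 / alpha1) +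
  Num.ceil (k%:R / alpha2 - beta2 / alpha2).
have FG k : F k = G k + (k * m)%N%:Z.
  rewrite /F /G -addrA; congr (_ + _).
  rewrite -[(k * m)%N%:Z](@intrKceil R) -ceilDrz ?intr_int//; congr Num.ceil.
  by rewrite -[(k * m)%N%:Z%:~R]/((k * m)%:R) natrM -sum_inv; ring.
have big : \forall k \near \oo,
    (\sum_(S <- [:: beatty alpha1 beta1; beatty alpha2 beta2]) S k%:Z)%E
    = (F k.+1 - F k)%:~R%:E.
  near=> k.
  rewrite !big_cons big_nil adde0 !beatty_ceil//;
    [|near: k; exact: nbhs_infty_gtr..].
  rewrite -EFinD -intrD; congr (_%:~R%:E).
  by rewrite -[k%:Z + 1]/((k + 1)%N%:Z) addn1 /F; ring.
have step k : (F k.+1 - F k = m%:Z) <-> (G k.+1 = G k).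
  by rewrite !FG; split; lia.
split => H; near=> k.
  apply/step/(@intr_inj R)/EFin_inj.
  by rewrite -(near big k) //; near: k.
rewrite (near big k) //; congr (_%:E).
have /step -> // : G k.+1 = G k by near: k.
Unshelve. all: by end_near.
Qed.

Theorem theorem1p10 (R : realType) (m : nat) (alpha1 beta1 alpha2 beta2 : R)
    (m_gt0 : (0 < m)%N)
    (alpha1_gt0 : 0 < alpha1) (alpha2_gt0 : 0 < alpha2)
    (alpha1_irr : alpha1 \in @irrational R)
    (alpha2_irr : alpha2 \in @irrational R)
    (sum_inv : 1 / alpha1 + 1 / alpha2 = m%:R) :
  is_EEC m [:: beatty alpha1 beta1; beatty alpha2 beta2] <->
  beta1 / alpha1 + beta2 / alpha2 \is a Num.int.
Proof.
apply: iff_trans; first exact: is_EEC_beatty_pair.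
set s := beta1 / alpha1 + _; set c := beta1 / alpha1.
have girr := irrationalV _ _ alpha1_irr.
split => [[N _ GE] | s_int].
  apply: contrapT => /negP s_nint.
  pose r := Num.floor s.
  have [rs sr] : r%:~R < s /\ s < r%:~R + 1.
    have /andP[rs sr] := floor_itv s; split; last by rewrite -intrD1.
    rewrite lt_neqAle rs andbT; apply: contraNneq s_nint => <-.
    exact: intr_int.
  have Gcst k : (N <= k)%N ->
      Num.ceil (k%:R / alpha1 - c) + Num.ceil (- (k%:R / alpha1 - c) - s) =
      Num.ceil (N%:R / alpha1 - c) + Num.ceil (- (N%:R / alpha1 - c) - s).
    elim: k => [|k IH]; first by rewrite leqn0 => /eqP ->.
    rewrite leq_eqVlt => /predU1P[-> //|/[!ltnS] Nk].
    by rewrite -IH//; exact: GE.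
  (* Modulo 1, [k1] puts x_k in (-1, r - s), where the sum of ceilings is [1 - r]; [k2] puts it in
     (r - s, 0), where the sum is [- r]. *)
  have [|k1 [p1 [Nk1 /andP[a1 b1]]]] :=
    kronecker _ _ (- c) (-1) (- (s - r%:~R)) N girr; first by lra.
  have [|k2 [p2 [Nk2 /andP[a2 b2]]]] :=
    kronecker _ _ (- c) (- (s - r%:~R)) 0 N girr; first by lra.
  have := Gcst _ Nk1; rewrite -(Gcst _ Nk2).
  rewrite (@ceil_def _ _ p1); last by rewrite intrB; lra.
  rewrite (@ceil_def _ _ (1 - r - p1)); last by rewrite !intrB; lra.
  rewrite (@ceil_def _ _ p2); last by rewrite intrB; lra.
  rewrite (@ceil_def _ _ (- r - p2)); last by rewrite !intrB intrN; lra.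
  by lia.
pose x (k : nat) := k%:R / alpha1 - c.
have x_nint : \forall k \near \oo, x k \isn't a Num.int.
  (* Two integer values of [x] would make a positive multiple of [alpha1^-1] an integer. *)
  have [[k0 /intrP[p0 xk0]]|] := pselect (exists k, x k \is a Num.int).
    exists k0.+1 => // k /= k0k; apply/negP => /intrP[p xk].
    have /eqP[] := natmul_irrational_neq _ _ (k - k0) (p - p0) girr
      ltac:(by rewrite subn_gt0).
    by rewrite natrB 1?ltnW// intrB -xk -xk0 /x; ring.
  by move=> nx; exists 0%N => // k _; apply/negP => ?; apply: nx; exists k.
(* The integer [s] comes out of the ceiling, and [ceil x + ceil (- x) = 1] for non-integer [x]. *)
have GE k : x k \isn't a Num.int ->
    Num.ceil (x k) + Num.ceil (- x k - s) = 1 - Num.ceil s.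
  move=> xk; rewrite [Num.ceil (- x k - s)]ceilDrz ?rpredN// [Num.ceil (- s)]ceilN//.
  rewrite addrA [Num.ceil (x k)]ceil_floor xk.
  rewrite [Num.ceil (- x k)]ceilNfloor opprK.
  by congr (_ - _); rewrite addrAC subrr add0r.
have [N _ xN] := x_nint.
exists N => // k Nk; rewrite -!/(x _) !GE//; apply: xN => //=.
exact: leqW.
Qed.
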